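(* Consider the AURWM regime (defined in the context) with $n=\lfloor p^k\rfloor$ for some fixed $k\in(0,1)$. Whenever $r<1$, there exists a universal positive constant $c$ such that $$\lim_{p\to\infty}\ \inf_{\widehat{\mathcal S}}\ \sup_{\beta\in\mathcal{M}_s^a}\ \mathbb{P}_\beta\big(\widehat{\mathcal S}\neq\mathcal{S}(\beta)\big)\ge c,$$ where the infimum is over all measurable functions $\widehat{\mathcal S}:(X,Y)\mapsto\widehat{\mathcal S}(X,Y)\in\{\mathcal D\subseteq[p]:|\mathcal D|=s\}$.
   Context: Model: $Y=X\beta+E$, where $X\in\mathbb{R}^{n\times p}$ has i.i.d. rows $x_i\sim N_p(0,I_p)$, $E$ has i.i.d. $N(0,1)$ entries, and $X,E$ are independent. $\mathbb{P}_\beta$ is the law of the data when the coefficient vector is $\beta\in\mathbb{R}^p$. $\mathcal{S}(v)=\{j: v_j\neq 0\}$ is the support of $v\in\mathbb{R}^p$, and $\|v\|_0=|\mathcal{S}(v)|$. Signal class: $\mathcal{M}_s^a=\{\beta\in\mathbb{R}^p:\ \|\beta\|_0=s,\ \min_{j\in\mathcal{S}(\beta)}|\beta_j|\ge a\}$. AURWM regime: $p\to\infty$, $n=\lfloor p^k\rfloor$ with fixed $k\in(0,1)$, sparsity $s=s_p=O(\log p)$, and $a=\left(\frac{2r\log p}{n}\right)^{1/2}$ where $r>0$ is a fixed constant. *)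

(* Defs.v *)
From HB Require Import structures.
From mathcomp Require Import all_boot all_order all_algebra.
From mathcomp Require Import all_classical all_reals all_analysis.
From mathcomp Require Import measurable_realfun.

Set Implicit Arguments.
Unset Strict Implicit.
Unset Printing Implicit Defensive.

Import Order.TTheory GRing.Theory Num.Theory.
Import numFieldNormedType.Exports.

Local Open Scope classical_set_scope.
Local Open Scope ring_scope.

Section iid.
Context d (T : measurableType d) (R : realType).

Definition cons_pair n (x : T * n.-tuple T) : n.+1.-tuple T :=
  [the n.+1.-tuple T of x.1 :: x.2].

Lemma measurable_cons_pair n :
  measurable_fun [set: T * n.-tuple T] (@cons_pair n).
Proof. exact: measurable_cons. Qed.

HB.instance Definition _ n :=
  isMeasurableFun.Build _ _ _ _ (@cons_pair n) (@measurable_cons_pair n).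

(* The n-fold product measure P^n: the joint law of n independent variables
   with common law P. *)
Fixpoint iid (P : probability T R) n : probability (n.-tuple T) R :=
  if n is m.+1 then distribution (P \x iid P m)%E (@cons_pair m)
  else dirac [tuple].

End iid.

Section linear_model.
Context {R : realType}.

(* N_p(0, I_p), as the law of p independent N(0, 1) coordinates. *)
Definition std_gaussian p : probability (p.-tuple (measurableTypeR R)) R :=
  iid (normal_prob 0 1) p.

(* A design matrix is stored as the tuple of its rows: tuples, unlike
   matrices, carry a product sigma-algebra in the library. *)
Definition design n p := n.-tuple (p.-tuple (measurableTypeR R)).
Definition response n := n.-tuple (measurableTypeR R).
Definition data n p := (design n p * response n)%type.

Definition mx_of_design n p (X : design n p) : 'M[R]_(n, p) :=
  \matrix_(i, j) tnth (tnth X i) j.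

Definition cV_of_response n (E : response n) : 'cV[R]_n := \col_i tnth E i.

(* (X, E) |-> (X, X beta + E) *)
Definition observe n p (beta : 'cV[R]_p) (XE : data n p) : data n p :=
  let Y := mx_of_design XE.1 *m beta + cV_of_response XE.2 in
  (XE.1, [tuple Y i ord0 | i < n]).

Lemma measurable_observe n p (beta : 'cV[R]_p) :
  measurable_fun [set: data n p] (@observe n p beta).
Proof.
apply/measurable_fun_pairP; split; first exact: measurable_fst.
apply/measurable_fun_tnthP => i.
rewrite (_ : _ \o _ = fun XE : data n p =>
    \sum_(j < p) tnth (tnth XE.1 i) j * beta j ord0 + tnth XE.2 i); last first.
  apply/funext => XE /=; rewrite tnth_mktuple !mxE; congr (_ + _).
  by apply: eq_bigr => j _; rewrite !mxE.
apply: measurable_funD.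
  apply: measurable_sum => j; apply: measurable_funM => //.
  apply: (measurableT_comp (measurable_tnth j)).
  apply: (measurableT_comp (measurable_tnth i)).
  exact: measurable_fst.
apply: (measurableT_comp (measurable_tnth i)); exact: measurable_snd.
Qed.

HB.instance Definition _ n p (beta : 'cV[R]_p) :=
  isMeasurableFun.Build _ _ _ _ (@observe n p beta) (measurable_observe beta).

(* P_beta, the law of (X, Y): the rows of X are i.i.d. N_p(0, I_p), the entries
   of E are i.i.d. N(0, 1), and X, E are independent. *)
Definition data_law n p (beta : 'cV[R]_p) : probability (data n p) R :=
  distribution (iid (std_gaussian p) n \x iid (normal_prob 0 1) n)%E
    (@observe n p beta).

Definition coef_support p (v : 'cV[R]_p) : {set 'I_p} :=
  [set j : 'I_p | v j ord0 != 0]%SET.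

Definition signal_class p (s : nat) (a : R) : set 'cV[R]_p :=
  [set beta | #|coef_support beta| = s /\
    forall j, j \in coef_support beta -> a <= `|beta j ord0|].

(* {D | #|D| = s} carries its discrete sigma-algebra. *)
Definition support_estimator n p (s : nat) : set (data n p -> {set 'I_p}) :=
  [set Shat : data n p -> {set 'I_p} | (forall x, #|Shat x| = s) /\
    forall A : set {set 'I_p}, measurable (Shat @^-1` A)].

Definition error_prob n p (Shat : data n p -> {set 'I_p}) (beta : 'cV[R]_p)
    : \bar R :=
  data_law n beta [set x | Shat x != coef_support beta].

Definition minimax_risk n p (s : nat) (a : R) : \bar R :=
  ereal_inf [set ereal_sup [set error_prob Shat beta |
    beta in @signal_class p s a] | Shat in @support_estimator n p s].

Definition sample_size (k : R) (p : nat) : nat := Num.truncn (p%:R `^ k).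

Definition signal_strength (k r : R) (p : nat) : R :=
  Num.sqrt (2 * r * ln p%:R / (sample_size k p)%:R).

End linear_model.

(* Main.v *)
Require Import Defs.
From HB Require Import structures.
From mathcomp Require Import all_boot all_order all_algebra.
From mathcomp Require Import all_classical all_reals all_analysis.
From mathcomp Require Import measurable_realfun ring lra.
Import Order.TTheory GRing.Theory Num.Theory.
Import numFieldNormedType.Exports.
Local Open Scope classical_set_scope.
Local Open Scope ring_scope.

(** The minimax risk tends to 1, so any positive [c <= 1] will do.

    It never exceeds 1, because estimators exist as soon as [s <= p].  For the
    lower bound, give the estimator all but one element of the support: let
    [beta0] have all its nonzero entries equal to [a] on the first [s - 1]
    coordinates, and let [beta_j = beta0 + a e_j], where [j] is one of the
    [m = p - s + 1] other coordinates.  Under the law of [beta0] the [m] events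
    that the estimator answers [supp beta_j] are disjoint, so one of them has
    probability at most [1 / m] ([probability_pigeonhole]).  It remains to see
    that passing from [beta0] to that [beta_j] cannot make this event likely.

    Given the design, passing from [beta0] to [beta_j] translates the Gaussian
    noise by [v = a X_j], which multiplies its density by [L = exp w], where
    [w = <v, e> - |v|^2 / 2] ([iid_normal_tilt]).  For every level [t] and every
    [lam >= 0] one has [L <= e^t + e^(- lam t) L^(1 + lam)].  Hence the success
    probability under [beta_j] is at most [e^t / m] plus
    [e^(- lam t) E[L^(1 + lam)]] ([iid_normal_shift_le]).  The last expectation
    is explicit: it is [exp (lam (1 + lam) |v|^2 / 2)] given the design.
    Averaging over the Gaussian column [X_j] gives at most
    [exp (n th / (1 - 2 th))], where [th = lam (1 + lam) a^2 / 2]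
    ([data_law_add_delta_le]).

    In the given regime [n a^2 = 2 r ln p] and [th] tends to 0, so
    [n th / (1 - 2 th)] is about [lam (1 + lam) r ln p].  With
    [t = l ln p] and [r < l < 1] the two error terms are about [p^(l - 1)] and
    [p^(- lam (l - (1 + lam) r))].  Both vanish once [lam] is so small that
    [(1 + lam) r < l] ([minimax_risk_ge_asymptotic]).  The sparsity
    enters only through [m >= p / 2], which follows from [s = O(ln p)]. *)

(** * Measures with a density *)

Section density.
Local Open Scope ereal_scope.
Import HBNNSimple.

Lemma ge0_integral_density d (T : measurableType d) (R : realType)
    (mu nu : {measure set T -> \bar R}) (h : T -> R)
    (f : T -> \bar R) :
  measurable_fun setT h -> (forall x, 0 <= h x)%R ->
  (forall A, measurable A -> nu A = \int[mu]_(x in A) (h x)%:E) ->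
  measurable_fun setT f -> (forall x, 0 <= f x) ->
  \int[nu]_x f x = \int[mu]_x (f x * (h x)%:E).
Proof.
move=> mhR hR0 nuE mf f0.
have mh : measurable_fun setT (fun x => (h x)%:E) by exact/measurable_EFinP.
have h0 x : 0 <= (h x)%:E by rewrite lee_fin.
have step (g : {nnsfun T >-> R}) :
    \int[nu]_x (g x)%:E = \int[mu]_x ((g x)%:E * (h x)%:E).
  rewrite integralT_nnsfun sintegralE.
  under [RHS]eq_integral.
    move=> x _; rewrite fimfunE -fsumEFin// ge0_mule_fsuml; last first.
      by move=> r; rewrite EFinM nnfun_muleindic_ge0.
    over.
  rewrite ge0_integral_fsum//; last 2 first.
  - move=> r; apply: emeasurable_funM => //.
    by apply/measurable_EFinP/measurable_funM => //; exact: measurable_indic.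
  - by move=> r x _; rewrite mule_ge0// EFinM nnfun_muleindic_ge0.
  apply: eq_fsbigr => r; rewrite inE => -[x0 _ <-].
  rewrite nuE//.
  under [RHS]eq_integral do rewrite EFinM -muleA.
  rewrite ge0_integralZl ?lee_fin//; last 2 first.
  - apply: emeasurable_funM => //; exact/measurable_EFinP/measurable_indic.
  - by move=> x _; rewrite mule_ge0// lee_fin.
  congr (_ * _); rewrite integral_mkcond; apply: eq_integral => x _.
  rewrite patchE indicE; case: ifPn => _; first by rewrite mul1e.
  by rewrite mul0e.
pose g := nnsfun_approx measurableT mf.
have gf x : (g n x)%:E @[n --> \oo] --> f x by exact: cvg_nnsfun_approx.
have fE x : f x = limn (fun n => (g n x)%:E) by apply/esym/cvg_lim.
transitivity (limn (fun n => \int[nu]_x (g n x)%:E)).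
  rewrite -monotone_convergence//.
  - exact: eq_integral.
  - by move=> n; exact/measurable_EFinP.
  - by move=> n x _; rewrite lee_fin.
  - by move=> x _ a b ab; rewrite lee_fin; exact/lefP/nd_nnsfun_approx.
under eq_fun do rewrite step.
rewrite -monotone_convergence//.
- apply: eq_integral => x _; apply/cvg_lim => //.
  exact: cvgeZr.
- by move=> n; apply: emeasurable_funM => //; exact/measurable_EFinP.
- by move=> n x _; rewrite mule_ge0// lee_fin.
- move=> x _ a b ab; rewrite lee_wpmul2r// lee_fin.
  exact/lefP/nd_nnsfun_approx.
Qed.
End density.

(** * The standard normal law on the line *)

Section normal_law.
Variable R : realType.
Local Open Scope ereal_scope.
Local Notation mu := (@lebesgue_measure R).
Local Notation N := (@normal_prob R 0 1).

Lemma ge0_integral_lebesgue_shift (v : R) (f : measurableTypeR R -> \bar R) :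
  measurable_fun setT f -> (forall x, 0 <= f x) ->
  \int[mu]_x f (v + x)%R = \int[mu]_x f x.
Proof.
move=> mf f0.
pose phi (x : measurableTypeR R) : measurableTypeR R := (v + x)%R.
have mphi : measurable_fun setT phi by exact: measurable_funD.
rewrite -[LHS]/(\int[mu]_(x in phi @^-1` setT) (f \o phi) x).
rewrite -(ge0_integral_pushforward mphi mu)//.
apply: eq_measure_integral => A mA _; apply/esym.
apply: (@lebesgue_measure_unique R (pushforward mu phi)) => //.
move=> X [[a b] _ <-] /=; rewrite /pushforward.
have -> : phi @^-1` `]a, b]%classic = `](a - v)%R, (b - v)%R]%classic.
  by apply/seteqP; split => x /=;
    rewrite !in_itv/= /phi => /andP[? ?]; apply/andP; split; lra.
rewrite !lebesgue_measure_itv/= !lte_fin ltrD2r.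
by case: ifP => // _; rewrite -!EFinB; congr EFin; ring.
Qed.

Lemma ge0_integral_normal_prob (f : measurableTypeR R -> \bar R) :
  measurable_fun setT f -> (forall x, 0 <= f x) ->
  \int[N]_x f x = \int[mu]_x (f x * (normal_pdf 0 1 x)%:E).
Proof.
move=> mf f0; apply: ge0_integral_density => //.
- exact: measurable_normal_pdf.
- by move=> x; rewrite normal_pdf_ge0.
Qed.

(** Translation invariance of the Lebesgue measure reduces the claim to the ratio
    of two normal densities. *)
Lemma normal_prob_tilt (v : R) (f : measurableTypeR R -> \bar R) :
  measurable_fun setT f -> (forall x, 0 <= f x) ->
  \int[N]_x f (v + x)%R =
  \int[N]_x (f x * (expR (v * x - v ^+ 2 / 2))%:E).
Proof.
move=> mf f0.
have mshift : measurable_fun [set: measurableTypeR R]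
   (fun x : measurableTypeR R => (v + x)%R : measurableTypeR R).
  exact: measurable_funD.
have mpdf := @measurable_normal_pdf R 0 1.
rewrite ge0_integral_normal_prob//; last exact: (measurableT_comp mf).
rewrite ge0_integral_normal_prob//; last 2 first.
- apply: emeasurable_funM => //; apply/measurable_EFinP/measurableT_comp => //.
  by apply: measurable_funB => //; exact: measurable_funM.
- by move=> x; rewrite mule_ge0// lee_fin expR_ge0.
rewrite -[RHS](ge0_integral_lebesgue_shift v); last 2 first.
- apply: emeasurable_funM; last exact/measurable_EFinP.
  apply: emeasurable_funM => //; apply/measurable_EFinP/measurableT_comp => //.
  by apply: measurable_funB => //; exact: measurable_funM.
- by move=> x; rewrite !mule_ge0// lee_fin ?expR_ge0// normal_pdf_ge0.
apply: eq_integral => x _; rewrite -muleA; congr (_ * _).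
rewrite -EFinM !normal_pdfE ?oner_neq0//; congr EFin.
rewrite mulrCA; congr (_ * _)%R; rewrite /normal_fun -expRD; congr expR.
by field.
Qed.

(** Up to the factor [sg = (1 - 2 th)^(-1/2)], the tilted density is the normal
    density of standard deviation [sg], so the integral equals [sg].  The
    exponential form of the bound multiplies well over the [n] entries of a
    column. *)
Lemma normal_prob_chi2_mgf_le (th : R) : (0 <= th)%R -> (th < 2^-1)%R ->
  \int[N]_x (expR (th * x ^+ 2))%:E <= (expR (th / (1 - 2 * th)))%:E.
Proof.
move=> th0 th1.
have q0 : (0 < 1 - 2 * th)%R by lra.
pose sg := (Num.sqrt (1 - 2 * th))^-1%R.
have sg0 : (0 < sg)%R by rewrite invr_gt0 sqrtr_gt0.
have sgE : (sg ^+ 2 = (1 - 2 * th)^-1)%R.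
  by rewrite /sg exprVn sqr_sqrtr// ltW.
rewrite ge0_integral_normal_prob; last 2 first.
- apply/measurable_EFinP/measurableT_comp => //; apply: measurable_funM => //.
- by move=> x; rewrite lee_fin expR_ge0.
rewrite (eq_integral (fun x : measurableTypeR R =>
    sg%:E * (normal_pdf 0 sg x)%:E)); last first.
  move=> x _; rewrite -!EFinM !normal_pdfE ?oner_neq0 ?gt_eqF//; congr EFin.
  have -> : (normal_peak 1 = sg * normal_peak sg)%R.
    rewrite /normal_peak -!mulrnAr !(@sqrtrM _ (_ ^+ 2)%R) ?sqr_ge0// !sqrtr_sqr.
    by rewrite normr1 mul1r gtr0_norm// invfM mulrA divff ?gt_eqF// mul1r.
  rewrite mulrCA -mulrA; congr (_ * _)%R; congr (_ * _)%R.
  rewrite /normal_fun -expRD sgE; congr expR.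
  by field; rewrite gt_eqF.
rewrite ge0_integralZl//; last 3 first.
- by apply/measurable_EFinP; exact: measurable_normal_pdf.
- by move=> x _; rewrite lee_fin normal_pdf_ge0.
- by rewrite lee_fin ltW.
rewrite integral_normal_pdf mule1 lee_fin.
(* Squared, the claim reads [1 + y <= expR y] with [y = 2 th / (1 - 2 th)]. *)
rewrite -(@ler_pXn2r _ 2%N) ?nnegrE ?expR_ge0 ?(ltW sg0)// sgE -expRM_natl.
apply: le_trans (expR_ge1Dx _); rewrite le_eqVlt; apply/orP; left; apply/eqP.
by field; rewrite gt_eqF.
Qed.
End normal_law.

(** * Products of independent coordinates *)

Section iid_integral.
Context d (T : measurableType d) (R : realType) (P : probability T R).
Local Open Scope ereal_scope.

Lemma ge0_integral_iidS n (f : n.+1.-tuple T -> \bar R) :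
  measurable_fun setT f -> (forall x, 0 <= f x) ->
  \int[iid P n.+1]_x f x =
  \int[P]_x \int[iid P n]_y f (cons_pair (x, y)).
Proof.
move=> mf f0; rewrite /= ge0_integral_distribution// fubini_tonelli1//.
- by apply: measurableT_comp => //; exact: measurable_cons_pair.
- by move=> x /=.
Qed.

Lemma tnth_cons_pair0 n (x : T) (y : n.-tuple T) :
  tnth (cons_pair (x, y)) ord0 = x.
Proof. by []. Qed.

Lemma tnth_cons_pairS n (x : T) (y : n.-tuple T) i :
  tnth (cons_pair (x, y)) (lift ord0 i) = tnth y i.
Proof. exact: tnthS. Qed.

(** Stated as an inequality, with a bound for each factor, because the factors
    to be integrated are themselves only bounded. *)
Lemma integral_iid_prod_le n (f : 'I_n -> T -> R) (c : 'I_n -> R) :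
  (forall i, measurable_fun setT (f i)) -> (forall i x, 0 <= f i x)%R ->
  (forall i, \int[P]_x (f i x)%:E <= (c i)%:E) ->
  \int[iid P n]_x (\prod_(i < n) f i (tnth x i))%:E <= (\prod_(i < n) c i)%:E.
Proof.
elim: n f c => [|n IHn] f c mf f0 fc.
  under eq_integral do rewrite big_ord0.
  by rewrite big_ord0 integral_cst//= mul1e; exact: probability_le1.
have mprod m (g : 'I_m -> T -> R) : (forall i, measurable_fun setT (g i)) ->
    measurable_fun setT (fun x : m.-tuple T => \prod_(i < m) g i (tnth x i))%R.
  move=> mg; apply: measurable_prod => i _.
  exact: (measurableT_comp (mg i) (measurable_tnth i)).
have c0 i : (0 <= c i)%R.
  by rewrite -lee_fin (le_trans _ (fc i))// integral_ge0// => x _; rewrite lee_fin.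
rewrite ge0_integral_iidS; last 2 first.
- by apply/measurable_EFinP; exact: (mprod _ f).
- by move=> x; rewrite lee_fin prodr_ge0.
rewrite big_ord_recl EFinM.
have IH := IHn (fun i => f (lift ord0 i)) (fun i => c (lift ord0 i))
  (fun i => mf _) (fun i => f0 _) (fun i => fc _).
rewrite (eq_integral (fun x => (f ord0 x)%:E *
    \int[iid P n]_y (\prod_(i < n) f (lift ord0 i) (tnth y i))%:E)); last first.
  move=> x _; rewrite -ge0_integralZl//; last 3 first.
  - by apply/measurable_EFinP; exact: (mprod _ (fun i => f (lift ord0 i))).
  - by move=> y _; rewrite lee_fin prodr_ge0.
  - by rewrite lee_fin.
  apply: eq_integral => y _; rewrite big_ord_recl -EFinM; congr (_ * _)%:E.
  by apply: eq_bigr => i _; rewrite tnth_cons_pairS.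
rewrite ge0_integralZr//; last 3 first.
- exact/measurable_EFinP.
- by move=> x _; rewrite lee_fin.
- by apply: integral_ge0 => y _; rewrite lee_fin prodr_ge0.
apply: lee_pmul => //.
- by apply: integral_ge0 => x _; rewrite lee_fin.
- by apply: integral_ge0 => y _; rewrite lee_fin prodr_ge0.
Qed.

End iid_integral.

(** * Translations of Gaussian noise *)

Section tilt.
Context {R : realType}.
Local Notation N := (@normal_prob R 0 1).
Local Open Scope ereal_scope.

Definition shift_response n (v : 'I_n -> R) (e : response n) : response n :=
  [tuple (v i + tnth e i)%R | i < n].

Lemma measurable_shift_response n (v : 'I_n -> R) :
  measurable_fun setT (shift_response n v).
Proof.
apply/measurable_fun_tnthP => i.
rewrite (_ : _ \o _ = fun e : response n => (v i + tnth e i)%R); last first.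
  by apply/funext => e /=; rewrite tnth_mktuple.
by apply: measurable_funD => //; exact: measurable_tnth.
Qed.

(** The logarithm of the likelihood ratio of the translated noise [v + e] with
    respect to [e]. *)
Definition log_lr n (v : 'I_n -> R) (e : response n) : R :=
  \sum_(i < n) (v i * tnth e i - v i ^+ 2 / 2).

Lemma measurable_log_lr n (v : 'I_n -> R) : measurable_fun setT (log_lr n v).
Proof.
apply: measurable_sum => i; apply: measurable_funB => //.
by apply: measurable_funM => //; exact: measurable_tnth.
Qed.

(** Coordinate by coordinate, from [normal_prob_tilt] and Tonelli's theorem. *)
Lemma iid_normal_tilt n (v : 'I_n -> R) (f : response n -> \bar R) :
  measurable_fun setT f -> (forall x, 0 <= f x) ->
  \int[iid N n]_e f (shift_response n v e) =
  \int[iid N n]_e (f e * (expR (log_lr n v e))%:E).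
Proof.
elim: n v f => [|n IHn] v f mf f0.
  apply: eq_integral => e _; rewrite /log_lr big_ord0 expR0 mule1.
  by congr f; rewrite [LHS]tuple0 [RHS]tuple0.
pose v' i := v (lift ord0 i).
have mexp m (u : 'I_m -> R) :
    measurable_fun setT (fun e : response m => (expR (log_lr m u e))%:E).
  by apply/measurable_EFinP/measurableT_comp => //; exact: measurable_log_lr.
have shiftE x y : shift_response n.+1 v (cons_pair (x, y)) =
    cons_pair ((v ord0 + x)%R, shift_response n v' y).
  apply: eq_from_tnth => i; rewrite tnth_mktuple.
  case: (unliftP ord0 i) => [j ->|->]; last by rewrite !tnth_cons_pair0.
  by rewrite !tnth_cons_pairS tnth_mktuple.
have log_lrE x y : log_lr n.+1 v (cons_pair (x, y)) =
    (v ord0 * x - v ord0 ^+ 2 / 2 + log_lr n v' y)%R.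
  rewrite /log_lr big_ord_recl tnth_cons_pair0; congr (_ + _)%R.
  by apply: eq_bigr => i _; rewrite tnth_cons_pairS.
have mfc : measurable_fun setT (f \o @cons_pair _ (measurableTypeR R) n).
  by apply: measurableT_comp => //; exact: measurable_cons_pair.
pose g (z : measurableTypeR R * response n) :=
  f (cons_pair z) * (expR (log_lr n v' z.2))%:E.
have mg : measurable_fun setT g.
  apply: emeasurable_funM => //.
  exact: (measurableT_comp (mexp n v') measurable_snd).
have g0 z : 0 <= g z by rewrite mule_ge0// lee_fin expR_ge0.
rewrite ge0_integral_iidS//; last first.
  by apply: measurableT_comp => //; exact: measurable_shift_response.
rewrite ge0_integral_iidS//; last 2 first.
- by apply: emeasurable_funM => //; exact: mexp.
- by move=> e; rewrite mule_ge0// lee_fin expR_ge0.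
pose G (x : measurableTypeR R) := \int[iid N n]_y g (x, y).
transitivity (\int[N]_x G (v ord0 + x)%R).
  apply: eq_integral => x _.
  under eq_integral do rewrite shiftE.
  rewrite (IHn v' (fun y => f (cons_pair ((v ord0 + x)%R, y))))//.
  exact: (measurableT_comp mfc (measurable_pair1 _)).
rewrite normal_prob_tilt; last 2 first.
- exact: (measurable_fun_fubini_tonelli_F _ mg).
- by move=> x; exact: integral_ge0.
apply: eq_integral => x _; rewrite -ge0_integralZr//.
- apply: eq_integral => y _.
  by rewrite /g/= log_lrE (expRD (_ - _)) EFinM muleAC -muleA.
- exact: (measurableT_comp mg (measurable_pair1 _)).
Qed.

(** A power of a likelihood ratio is again, up to a constant, the likelihood ratio
    of a translation; hence its expectation is that constant. *)
Lemma log_lr_scale n (a : R) (v : 'I_n -> R) e :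
  (a * log_lr n v e = log_lr n (fun i => a * v i) e +
     (a * (a - 1) / 2) * \sum_(i < n) v i ^+ 2)%R.
Proof.
rewrite /log_lr !mulr_sumr -big_split/=; apply: eq_bigr => i _.
by field.
Qed.

Lemma integral_expR_log_lr n (v : 'I_n -> R) :
  \int[iid N n]_e (expR (log_lr n v e))%:E = 1.
Proof.
transitivity (\int[iid N n]_e (cst 1 e * (expR (log_lr n v e))%:E)).
  by apply: eq_integral => e _; rewrite mul1e.
rewrite -(@iid_normal_tilt n v (cst 1))// ?integral_cst//= ?mul1e.
exact: probability_setT.
Qed.

(** Writing [w] for the log-likelihood ratio, [expR w <= expR t] where [w <= t],
    and elsewhere [expR w <= expR (- lam * t + (1 + lam) * w)].  The translation
    therefore multiplies the probability of [A] by at most [expR t], up to an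
    error controlled by the moment of order [1 + lam] of the ratio. *)
Lemma iid_normal_shift_le n (v : 'I_n -> R) (A : set (response n))
    (t lam : R) : measurable A -> (0 <= lam)%R ->
  iid N n (shift_response n v @^-1` A) <=
  (expR t)%:E * iid N n A +
  (expR (- lam * t + lam * (1 + lam) / 2 * \sum_(i < n) v i ^+ 2))%:E.
Proof.
move=> mA lam0.
have mexp (u : 'I_n -> R) :
    measurable_fun setT (fun e : response n => (expR (log_lr n u e))%:E).
  by apply/measurable_EFinP/measurableT_comp => //; exact: measurable_log_lr.
have mind : measurable_fun setT (fun e : response n => (\1_A e : R)%:E).
  exact/measurable_EFinP/measurable_indic.
have -> : iid N n (shift_response n v @^-1` A) =
    \int[iid N n]_e (\1_A (shift_response n v e))%:E.
  rewrite -(setIT (_ @^-1` A)) -integral_indic//.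
  by rewrite -[X in measurable X]setTI; exact: measurable_shift_response.
rewrite (iid_normal_tilt n v (EFin \o \1_A)); last 2 first.
- exact/measurable_EFinP/measurable_indic.
- by move=> e; rewrite lee_fin.
set K := (expR (- lam * t + lam * (1 + lam) / 2 * \sum_(i < n) v i ^+ 2))%R.
rewrite -[K%:E]mule1 -(integral_expR_log_lr n (fun i => (1 + lam) * v i)%R).
have -> : iid N n A = \int[iid N n]_e (\1_A e)%:E.
  by rewrite integral_indic// setIT.
rewrite -!ge0_integralZl ?lee_fin ?expR_ge0//.
rewrite -ge0_integralD//; last 3 first.
- exact: measurable_funeM.
- by move=> e _; rewrite -EFinM lee_fin mulr_ge0// expR_ge0.
- exact: measurable_funeM.
apply: ge0_le_integral => //.
- by move=> e _; rewrite mule_ge0// lee_fin// expR_ge0.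
- exact: emeasurable_funM.
- by apply: emeasurable_funD; exact: measurable_funeM.
move=> e _ /=; rewrite -!EFinM -EFinD lee_fin indicE.
have -> : (K * expR (log_lr n (fun i => (1 + lam) * v i) e) =
           expR (- lam * t + (1 + lam) * log_lr n v e))%R.
  rewrite log_lr_scale -expRD; congr expR; ring.
case: (e \in A); last by rewrite mul0r mulr0 add0r expR_ge0.
rewrite mul1r mulr1; have [wt|/ltW tw] := leP (log_lr n v e) t.
  by rewrite ler_wpDr ?expR_ge0// ler_expR.
rewrite ler_wpDl ?expR_ge0// ler_expR -subr_ge0.
by rewrite (_ : _ - _ = lam * (log_lr n v e - t))%R ?mulr_ge0 ?subr_ge0//; ring.
Qed.

End tilt.

(** * Adding one coefficient in the linear model *)

Section model.
Context {R : realType}.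
Local Notation N := (@normal_prob R 0 1).
Local Open Scope ereal_scope.

Lemma measurable_col_sqr n p (j : 'I_p) :
  measurable_fun setT
    (fun X : design n p => \sum_(i < n) tnth (tnth X i) j ^+ 2 : R)%R.
Proof.
apply: measurable_sum => i; apply: measurable_funX.
apply: (measurableT_comp (measurable_tnth j)).
exact: measurable_tnth.
Qed.

(** The entries of a column are independent standard normal variables: the rows
    are independent, and within each row only one factor is not 1. *)
Lemma integral_design_expR_le n p (j : 'I_p) (th : R) :
  (0 <= th)%R -> (th < 2^-1)%R ->
  \int[iid (std_gaussian p) n]_X
     (expR (th * \sum_(i < n) tnth (tnth X i) j ^+ 2))%:E <=
  (expR (n%:R * (th / (1 - 2 * th))))%:E.
Proof.
move=> th0 th1.
set c := (th / (1 - 2 * th))%R.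
have -> : expR (n%:R * c) = (\prod_(i < n) expR c)%R.
  by rewrite prodr_const card_ord expRM_natl.
under eq_integral do rewrite mulr_sumr expR_sum.
pose f (i : 'I_n) (x : p.-tuple (measurableTypeR R)) :=
  expR (th * tnth x j ^+ 2)%R.
apply: (@integral_iid_prod_le _ _ _ (std_gaussian p) n f) => //.
- move=> i; apply: measurableT_comp => //; apply: measurable_funM => //.
  by apply: measurable_funX; exact: measurable_tnth.
- by move=> i x; exact: expR_ge0.
move=> i; rewrite /f.
pose g (k : 'I_p) (x : measurableTypeR R) :=
  if k == j then expR (th * x ^+ 2)%R else 1%R.
pose d (k : 'I_p) := if k == j then expR c else 1%R.
have prodE (T : Type) (h : T -> R) (y : 'I_p -> T) :
    (\prod_(k < p) (if k == j then h (y k) else 1) = h (y j))%R.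
  by rewrite -big_mkcond big_pred1_eq.
have -> : expR c = (\prod_(k < p) d k)%R.
  by rewrite (prodE unit (fun=> expR c) (fun=> tt)).
under eq_integral => x _.
  rewrite -(prodE _ (fun z : R => expR (th * z ^+ 2)%R) (tnth x)).
  over.
apply: (@integral_iid_prod_le _ _ _ N p g).
- move=> k; rewrite /g; case: (k == j) => //.
  apply: measurableT_comp => //; apply: measurable_funM => //.
- by move=> k x; rewrite /g; case: ifP => // _; exact: expR_ge0.
- move=> k; rewrite /g /d; case: ifP => _.
    exact: normal_prob_chi2_mgf_le.
  by rewrite integral_cst// mul1e; exact: probability_le1.
Qed.

Lemma observe_add_delta n p (beta : 'cV[R]_p) (j : 'I_p) (a : R)
    (X : design n p) (e : response n) :
  observe (beta + a *: delta_mx j ord0) (X, e) =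
  observe beta (X, shift_response n (fun i => a * tnth (tnth X i) j)%R e).
Proof.
congr pair; apply: eq_from_tnth => i; rewrite !tnth_mktuple !mxE.
rewrite tnth_mktuple addrA; congr (_ + _)%R.
under eq_bigr do rewrite !mxE mulrDr.
rewrite big_split/=; congr (_ + _)%R.
  by apply: eq_bigr => k _; rewrite mxE.
rewrite (bigD1 j)//= big1 ?addr0 => [|k kj]; last first.
  by rewrite (negbTE kj)/= !mulr0.
by rewrite !eqxx mulr1 mulrC.
Qed.

(** [iid_normal_shift_le] given the design, with translation [a X_j], then the
    expectation over the design. *)
Lemma data_law_add_delta_le n p (beta : 'cV[R]_p) (j : 'I_p) (a t lam : R)
    (D : set (data n p)) :
  let th := (lam * (1 + lam) / 2 * a ^+ 2)%R in
  measurable D -> (0 <= lam)%R -> (th < 2^-1)%R ->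
  data_law n (beta + a *: delta_mx j ord0) D <=
  (expR t)%:E * data_law n beta D +
  (expR (- lam * t + n%:R * (th / (1 - 2 * th))))%:E.
Proof.
move=> th mD lam0 th1.
have th0 : (0 <= th)%R.
  by rewrite mulr_ge0 ?sqr_ge0// mulr_ge0 ?invr_ge0// mulr_ge0// addr_ge0.
have mobs b : measurable (@observe R n p b @^-1` D).
  by rewrite -[X in measurable X]setTI; exact: measurable_observe.
pose G := iid (@std_gaussian R p) n.
set B := @observe R n p beta @^-1` D.
have dE b : data_law n b D =
    \int[G]_X iid N n (xsection (@observe R n p b @^-1` D) X) by [].
have mx b : measurable_fun setT
    (fun X => iid N n (xsection (@observe R n p b @^-1` D) X)).
  exact: measurable_fun_xsection.
have msq : measurable_fun setT (fun X : design n p =>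
    (expR (th * \sum_(i < n) tnth (tnth X i) j ^+ 2))%:E).
  apply/measurable_EFinP/measurableT_comp => //.
  by apply: measurable_funM => //; exact: measurable_col_sqr.
rewrite !dE expRD EFinM.
apply: le_trans
  (leeD2l _ (lee_wpmul2l _ (integral_design_expR_le n p j th th0 th1))); last first.
  by rewrite lee_fin expR_ge0.
rewrite -!ge0_integralZl ?lee_fin ?expR_ge0//.
rewrite -ge0_integralD//; last 3 first.
- by move=> X _; rewrite mule_ge0// lee_fin expR_ge0.
- exact: measurable_funeM.
- exact: measurable_funeM.
apply: ge0_le_integral => //.
- by apply: emeasurable_funD; exact: measurable_funeM.
move=> X _.
pose v (i : 'I_n) := (a * tnth (tnth X i) j)%R.
have -> : xsection (observe (beta + a *: delta_mx j ord0) @^-1` D) X =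
    shift_response n v @^-1` (xsection B X).
  rewrite !xsectionE; apply/seteqP; split => e /=;
  by rewrite observe_add_delta.
apply: le_trans (iid_normal_shift_le n v _ t lam _ lam0) _.
  exact: (measurable_xsection _ (mobs beta)).
rewrite leeD2l// -EFinM lee_fin -expRD ler_expR lerD2l.
rewrite /th -[leRHS]mulrA le_eqVlt; apply/orP; left; apply/eqP.
by congr (_ * _)%R; rewrite mulr_sumr; apply: eq_bigr => i _; rewrite exprMn.
Qed.

End model.

(** * Bounds on the minimax risk *)

Section pigeonhole.
Local Open Scope ereal_scope.
Lemma probability_pigeonhole d (T : measurableType d) (R : realType)
    (P : probability T R) m (J : {pred 'I_m}) (F : 'I_m -> set T) :
  (0 < #|J|)%N -> (forall j, j \in J -> measurable (F j)) ->
  trivIset [set` J] F ->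
  exists2 j, j \in J & P (F j) <= ((#|J|%:R)^-1)%:E.
Proof.
move=> J0 mF tF; apply: contrapT => /forall2NP nex.
have lt j : j \in J -> (#|J|%:R^-1 < fine (P (F j)))%R.
  move=> jJ; have [//|/negP] := nex j.
  rewrite -ltNge -(fineK (fin_num_measure P _ (mF _ jJ))).
  by rewrite lte_fin.
have : (\sum_(j in J) fine (P (F j)) <= 1)%R.
  rewrite -lee_fin -sumEFin.
  rewrite (eq_bigr (fun j => P (F j))); last first.
    by move=> j jJ; rewrite fineK// fin_num_measure//; exact: mF.
  rewrite -(@measure_bigsetU_ord_cond _ _ _ P m J F)//.
  by apply: probability_le1; apply: bigsetU_measurable.
apply/negP; rewrite -ltNge.
have -> : (1 = \sum_(j in J) #|J|%:R^-1 :> R)%R.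
  by rewrite sumr_const -[RHS]mulr_natr mulVf// pnatr_eq0 -lt0n.
have [j0 j0J] : exists j, j \in J by apply/card_gt0P.
rewrite (bigD1 j0)// [ltRHS](bigD1 j0)//= ltr_leD ?lt//.
by apply: ler_sum => j /andP[jJ _]; rewrite ltW// lt.
Qed.
End pigeonhole.

Section minimax.
Context {R : realType}.
Local Open Scope ereal_scope.

Lemma card_ord_lt (p s : nat) : (s <= p)%N ->
  #|[set i : 'I_p | (i < s)%N]%SET| = s.
Proof.
move=> sp; rewrite cardsE -sum1_card.
by rewrite -(big_ord_widen p (fun=> 1%N) sp) sum1_card card_ord.
Qed.

Lemma minimax_risk_le1 n p s (a : R) : (s <= p)%N -> minimax_risk n p s a <= 1.
Proof.
move=> sp; pose S0 : {set 'I_p} := [set i : 'I_p | (i < s)%N]%SET.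
have mcst (A : set {set 'I_p}) :
    measurable ((fun=> S0 : {set 'I_p}) @^-1` A : set (data (R:=R) n p)).
  by rewrite preimage_cst; case: ifPn.
apply: ge_ereal_inf; exists (ereal_sup [set @error_prob R n p (fun=> S0) beta |
    beta in @signal_class R p s a]).
  exists (fun=> S0) => //; split => // _; exact: card_ord_lt.
apply: ge_ereal_sup => _ [beta _ <-].
by apply: probability_le1; exact: (mcst [set A | A != coef_support beta]).
Qed.

(** The least favourable coefficients share [s - 1] entries, so that the
    [(p - s).+1] candidate supports differ in a single element. *)
Lemma minimax_risk_ge n p s (a t lam : R) :
  let th := (lam * (1 + lam) / 2 * a ^+ 2)%R in
  (0 < s <= p)%N -> (0 < a)%R -> (0 <= lam)%R -> (th < 2^-1)%R ->
  (1 - (expR t / (p - s).+1%:R +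
        expR (- lam * t + n%:R * (th / (1 - 2 * th)))))%:E <=
  minimax_risk n p s a.
Proof.
case: s => [//|s] th /andP[_ sp] a0 lam0 th1.
apply: le_ereal_inf_tmp => _ [Shat [cardS mS] <-].
(* Here [s] is one less than the sparsity. *)
pose beta0 : 'cV[R]_p := \col_i (if (i < s)%N then a else 0%R).
pose S0 : {set 'I_p} := [set i : 'I_p | (i < s)%N]%SET.
pose J : {pred 'I_p} := [pred j : 'I_p | (s <= j)%N].
pose F j := Shat @^-1` [set (j |: S0)%SET].
have cardJ : #|J| = (p - s.+1).+1.
  rewrite -[LHS](eq_card (A := mem (~: S0)%SET)); last first.
    by move=> j; rewrite !inE -leqNgt.
  by rewrite cardsCs finset.setCK card_ord_lt ?card_ord ?subnSK// ltnW.
have tF : trivIset [set` J] F.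
  move=> i j /= iJ jJ [x [/= xi xj]].
  have : i \in (j |: S0)%SET by rewrite -xj xi setU11.
  by rewrite !inE ltnNge (iJ : (s <= i)%N) orbF => /eqP.
have [] := @probability_pigeonhole _ _ _ (data_law n beta0) p J F _ _ tF.
- by rewrite cardJ.
- by move=> j _; exact: mS.
move=> j jJ Fj.
pose beta : 'cV[R]_p := (beta0 + a *: delta_mx j ord0)%R.
have js (i : 'I_p) : (i < s)%N -> (i == j) = false.
  by move=> iS; apply/eqP => ij; move: jJ; rewrite inE leqNgt -ij iS.
have betaE i : beta i ord0 = if i \in (j |: S0)%SET then a else 0%R.
  rewrite !mxE !inE eqxx andbT; case: (boolP (i < s)%N) => [iS|_].
    by rewrite (js _ iS) mulr0 addr0 orbT.
  by rewrite orbF; case: ifP => _; rewrite ?mulr1 ?mulr0 add0r.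
have supp : coef_support beta = (j |: S0)%SET.
  apply/setP => i; rewrite inE betaE.
  by case: ifP; rewrite ?eqxx// gt_eqF.
apply: (@le_trans _ _ (error_prob Shat beta)); last first.
  apply: ereal_sup_ubound; exists beta => //; split; last first.
    by move=> i; rewrite supp betaE => ->; rewrite gtr0_norm.
  by rewrite supp cardsU1 inE (_ : (j < s)%N = false) ?card_ord_lt ?(ltnW sp)//;
    apply/negbTE; rewrite -leqNgt.
have -> : error_prob Shat beta = 1 - data_law n beta (F j).
  rewrite -probability_setC; last exact: mS.
  congr (data_law n beta _); apply/seteqP; split => x /=; rewrite supp.
    by move=> /eqP.
  by move=> ?; apply/eqP.
have finF b : exists q : R, data_law n b (F j) = q%:E.
  by exists (fine (data_law n b (F j))); rewrite fineK//;
    apply: fin_num_measure; exact: mS.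
have := @data_law_add_delta_le R n p beta0 j a t lam (F j) (mS _) lam0 th1.
have [q qE] := finF beta; have [q0 q0E] := finF beta0.
rewrite -/beta -/th qE; move: Fj; rewrite q0E => Fj.
rewrite -EFinB -EFinM -EFinD !lee_fin => h.
move: Fj; rewrite lee_fin cardJ => Fj.
rewrite lerD2l lerN2 (le_trans h)// lerD2r.
by rewrite ler_wpM2l ?expR_ge0.
Qed.

End minimax.

(** * Asymptotics *)

Section asymptotics.
Context {R : realType}.

Lemma near_ln_natr_ge (M : R) : \forall p \near \oo, M <= ln (p%:R : R).
Proof.
near=> p.
have Mp : expR M <= p%:R by near: p; exact: nbhs_infty_ger.
by rewrite -(expRK M) ler_ln ?posrE ?expR_gt0// (lt_le_trans _ Mp)// expR_gt0.
Unshelve. all: by end_near. Qed.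

Lemma cvg_expRN_ln_natr (c : R) : 0 < c ->
  expR (- (c * ln (p%:R : R))) @[p --> \oo] --> (0 : R).
Proof.
move=> c0.
apply: (@cvg_comp _ _ _ (fun p : nat => c * ln (p%:R : R))
  (fun x => expR (- x)) _ +oo); last exact: cvgr_expR.
apply/cvgryPge => A.
near=> p.
rewrite -ler_pdivrMl//; near: p; exact: near_ln_natr_ge.
Unshelve. all: by end_near. Qed.

Lemma expR_ge1Dsqr (x : R) : 0 <= x -> 1 + x ^+ 2 / 2 <= expR x.
Proof. by move=> x0; exact: (@expR_ge1Dxn R x 1). Qed.

(** With [L = ln p], [p^k = expR (k L)] dominates [(k L)^2 / 2], which is at least
    [4 L] for large [L]. *)
Lemma sample_size_ge (k : R) (p : nat) :
  0 < k -> 0 < ln (p%:R : R) -> 8 / k ^+ 2 <= ln (p%:R : R) ->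
  4 * ln (p%:R : R) <= (sample_size k p)%:R.
Proof.
set L := ln _ => k0 L0 hL.
have p0 : 0 < p%:R :> R.
  by rewrite ltNge; apply/negP => p0; move: L0; rewrite /L ln0 ?ltxx.
have h1 : p%:R `^ k < (sample_size k p)%:R + 1.
  by rewrite natr1 truncnS_gt.
have h2 : 1 + (k * L) ^+ 2 / 2 <= p%:R `^ k.
  rewrite /powR gt_eqF// expR_ge1Dsqr// mulr_ge0// ltW//.
have h3 : 8 <= k ^+ 2 * L by rewrite -ler_pdivrMl ?exprn_gt0// mulrC.
have h4 : 8 * L <= (k * L) ^+ 2.
  by rewrite exprMn expr2 [L ^+ 2]expr2 mulrA -expr2 ler_pM2r.
lra.
Qed.

Lemma double_sparsity_le (C : R) (p s : nat) : 0 < ln (p%:R : R) ->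
  4 * C <= ln (p%:R : R) -> s%:R <= C * ln (p%:R : R) -> 2 * s%:R <= p%:R :> R.
Proof.
set L := ln _ => L0 hL sL.
have p0 : 0 < p%:R :> R.
  by rewrite ltNge; apply/negP => p0; move: L0; rewrite /L ln0 ?ltxx.
have := expR_ge1Dsqr _ (ltW L0); rewrite lnK//.
have : 4 * C * L <= L ^+ 2 by rewrite expr2 ler_pM2r.
lra.
Qed.

(** [minimax_risk_ge] at level [t = l L], where [l] is the midpoint of [r] and 1.
    The order [lam] is chosen so that [(1 + lam)^2 r] stays below [l] by at least
    [(1 - r) / 4]: one factor [1 + lam] comes from the moment of order [1 + lam],
    the other absorbs [1 / (1 - 2 th)]. *)
Lemma minimax_risk_ge_asymptotic (k r C : R) (p s : nat) :
  let L := ln (p%:R : R) in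
  0 < k -> 0 < r -> r < 1 ->
  0 < L -> 8 / k ^+ 2 <= L -> 4 * C <= L ->
  (0 < s)%N -> s%:R <= C * L ->
  ((1 - (2 * expR (- ((1 - r) / 2 * L)) +
        expR (- ((1 - r) / 12 * ((1 - r) / 4) * L))))%:E <=
  minimax_risk (sample_size k p) p s (signal_strength k r p))%E.
Proof.
move=> L k0 r0 r1 L0 hL1 hL2 s0 sL.
have [lam lamE] : exists lam, lam = (1 - r) / 12 by exists ((1 - r) / 12).
have [l lE] : exists l, l = (1 + r) / 2 by exists ((1 + r) / 2).
rewrite -lamE (_ : (1 - r) / 2 = 1 - l); last lra.
have p0 : 0 < p%:R :> R.
  by rewrite ltNge; apply/negP => p0; move: L0; rewrite /L ln0 ?ltxx.
have pL : expR L = p%:R by rewrite /L lnK.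
have nL : 4 * L <= (sample_size k p)%:R by exact: sample_size_ge.
set n := sample_size k p in nL *.
have n0 : 0 < n%:R :> R by lra.
have s2p : 2 * s%:R <= p%:R :> R := double_sparsity_le C p s L0 hL2 sL.
have sp : (s <= p)%N by rewrite -(ler_nat R); have := ler0n R s; lra.
have q0 : 0 < 2 * r * ln p%:R / n%:R :> R.
  by rewrite -/L !mulr_gt0 ?invr_gt0.
set a := signal_strength k r p.
have a0 : 0 < a by rewrite sqrtr_gt0.
have aE : a ^+ 2 = 2 * r * (L / n%:R) by rewrite sqr_sqrtr ?ltW// mulrA.
have lam0 : 0 < lam by lra.
set x := L / n%:R in aE.
have x0 : 0 < x by rewrite divr_gt0.
have x4 : x <= 4^-1 by rewrite ler_pdivrMr//; lra.
have nx : n%:R * x = L by rewrite /x mulrCA divff ?mulr1// gt_eqF.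
pose u := (1 + lam) ^+ 2 * r.
have ul : u + (1 - r) / 4 <= l.
  have : (1 + lam) ^+ 2 * r <= (1 + 3 * lam) * r by rewrite ler_pM2r//; nra.
  have : lam * r <= lam by rewrite ler_piMr// ltW.
  rewrite -/u; lra.
have u0 : 0 < u by rewrite mulr_gt0// exprn_gt0//; lra.
pose th := lam * (1 + lam) / 2 * a ^+ 2.
have thE : th = lam * (1 + lam) * r * x by rewrite /th aE; field.
have th0 : 0 < th by rewrite thE mulr_gt0// mulr_gt0// mulr_gt0//; lra.
have thlam : 2 * th * (1 + lam) <= lam.
  have -> : 2 * th * (1 + lam) = lam * (2 * u * x) by rewrite thE /u; ring.
  rewrite ger_pMr//.
  have : u * x <= 1 * 4^-1 by apply: ler_pM => //; lra.
  lra.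
have th2 : th < 2^-1.
  have : 2 * th * 1 <= 2 * th * (1 + lam) by rewrite ler_pM2l; lra.
  lra.
have := @minimax_risk_ge R n p s a (l * L) lam _ a0 (ltW lam0) th2.
rewrite s0 sp => /(_ isT); apply: le_trans.
rewrite lee_fin lerD2l lerN2 -/th; apply: lerD.
- rewrite ler_pdivrMr ?ltr0n//.
  have -> : expR (l * L) = expR (- ((1 - l) * L)) * p%:R.
    by rewrite -pL -expRD; congr expR; ring.
  rewrite -mulrA mulrCA; apply: ler_wpM2l; first exact: expR_ge0.
  rewrite -(natr1 (p - s)%N) natrB//; lra.
- rewrite ler_expR.
  have : n%:R * (th / (1 - 2 * th)) <= lam * u * L.
    have -> : lam * u * L = n%:R * (th * (1 + lam)).
      by rewrite -nx thE /u; ring.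
    rewrite ler_pM2l// ler_pM2l// -[leLHS]mul1r ler_pdivrMr; last lra.
    lra.
  have : lam * L * (u + (1 - r) / 4) <= lam * L * l by rewrite ler_pM2l// mulr_gt0.
  lra.
Qed.

End asymptotics.

Theorem proposition1 (R : realType) :
  exists c : R, 0 < c /\
    forall (k r : R) (s : nat -> nat),
      0 < k < 1 -> 0 < r -> r < 1 ->
      (\forall p \near \oo, (0 < s p)%N) ->
      (fun p => (s p)%:R : R) =O_\oo (fun p => ln (p%:R : R)) ->
      let risk p :=
        minimax_risk (sample_size k p) p (s p) (signal_strength k r p) in
      cvgn risk /\ (c%:E <= limn risk)%E.
Proof.
exists 1; split=> // k r s /andP[k0 _] r0 r1 s0 /eqO_exP[C C0 sO] risk.
suff h : risk p @[p --> \oo] --> 1%:E.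
  by split; [exact: (cvgP _ h)|rewrite (cvg_lim _ h)].
pose err (p : nat) := 2 * expR (- ((1 - r) / 2 * ln (p%:R : R))) +
        expR (- ((1 - r) / 12 * ((1 - r) / 4) * ln (p%:R : R))).
have err0 : err p @[p --> \oo] --> 0.
  rewrite -[X in _ --> X]addr0 -[X in _ --> X + _](mulr0 2).
  apply: cvgD.
    by apply: cvgMr; apply: cvg_expRN_ln_natr; lra.
  by apply: cvg_expRN_ln_natr; rewrite mulr_gt0; lra.
apply: (@squeeze_cvge _ _ _ _ (fun p => (1 - err p)%:E) _ (cst 1%:E)); last 2 first.
- apply: cvg_EFin; first exact: nearW.
  rewrite -[X in _ --> X]subr0; apply: cvgB => //; exact: cvg_cst.
- exact: cvg_cst.
near=> p.
have L1 : 1 <= ln (p%:R : R) by near: p; exact: near_ln_natr_ge.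
have L2 : 8 / k ^+ 2 <= ln (p%:R : R) by near: p; exact: near_ln_natr_ge.
have L3 : 4 * C <= ln (p%:R : R) by near: p; exact: near_ln_natr_ge.
have sp : (0 < s p)%N by near: p.
have sC : (s p)%:R <= C * ln (p%:R : R).
  have : `|(s p)%:R : R| <= C * `|ln (p%:R : R)| by near: p.
  by rewrite !ger0_norm ?ler0n//; lra.
apply/andP; split.
  have L0 : 0 < ln (p%:R : R) by lra.
  exact: (@minimax_risk_ge_asymptotic R k r C p (s p) k0 r0 r1 L0 L2 L3 sp sC).
apply: minimax_risk_le1.
have : 2 * (s p)%:R <= p%:R :> R by apply: (double_sparsity_le C) => //; lra.
by rewrite -(ler_nat R); have := ler0n R (s p); lra.
Unshelve. all: by end_near. Qed.
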